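(* Let $f:\{0,1\}^n\to\{0,1\}$ be a non-constant function and let $d=\deg_2(f)\ge1$ be its $\mathrm{GF}(2)$-degree. Then $\mathrm{gran}(f^{\pm})\le n-\lceil n/d\rceil$, and consequently $\mathrm{gran}(f)\le n-\lceil n/d\rceil+1$.
   Context: $f^{\pm}=1-2f$. For $h:\{0,1\}^n\to\mathbb{R}$, $\hat h(S)=2^{-n}\sum_x h(x)(-1)^{\sum_{i\in S}x_i}$. A nonzero rational $r$ has granularity $\mathrm{gran}(r)=k$ if $r=m/2^k$ for some odd integer $m$; the Fourier granularity $\mathrm{gran}(h)$ of a function $h$ is the maximum of $\mathrm{gran}(\hat h(S))$ over all $S$ with $\hat h(S)\ne0$. *)

(* Defs.v *)
From mathcomp Require Import all_boot all_order all_algebra.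
From mathcomp Require Import reals.
From mathcomp Require Import mpoly.

Set Implicit Arguments.
Unset Strict Implicit.
Unset Printing Implicit Defensive.

Import Order.TTheory GRing.Theory Num.Theory.

Local Open Scope ring_scope.

Notation cube n := {ffun 'I_n -> bool}.

Section GF2Degree.

Variable n : nat.
Implicit Types (f : cube n -> bool) (p q : {mpoly 'F_2[n]}) (x : cube n).

Definition multilinear p : bool :=
  all (fun m : 'X_{1..n} => [forall i, (m i <= 1)%N]) (msupp p).

Definition represents p f : bool :=
  [forall x : cube n, p.@[fun i => (x i)%:R] == (f x)%:R].

Lemma multilinearD p q : multilinear p -> multilinear q -> multilinear (p + q).
Proof.
move=> /allP hp /allP hq; apply/allP => m /msuppD_le.
by rewrite mem_cat => /orP[/hp|/hq].
Qed.

Lemma multilinearN p : multilinear p -> multilinear (- p).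
Proof. by rewrite /multilinear (perm_all _ (msuppN p)). Qed.

Lemma multilinear0 : multilinear 0.
Proof. by rewrite /multilinear msupp0. Qed.

Lemma anf_exists f : exists p, multilinear p && represents p f.
Proof.
pose ind (a : cube n) : {mpoly 'F_2[n]} :=
  \prod_i ('X_i + (~~ a i)%:R%:MP_[n]).
exists (\sum_(a | f a) ind a); apply/andP; split.
  elim/big_ind: _ => [||a _]; [exact: multilinear0 | exact: multilinearD |].
  rewrite /ind bigA_distr.
  elim/big_ind: _ => [||J _]; [exact: multilinear0 | exact: multilinearD |].
  set m := [multinom (i \in J : nat) | i < n]%MM.
  suff -> : \prod_i (if i \in J then 'X_i else (~~ a i)%:R%:MP_[n])
      = (\prod_(i | i \notin J) (~~ a i)%:R) *: 'X_[m] :> {mpoly 'F_2[n]}.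
    apply/allP => m' /msuppZ_le; rewrite msuppX inE => /eqP ->.
    by apply/forallP => i; rewrite mnmE leq_b1.
  rewrite (bigID (mem J)) /= mulrC -mul_mpolyC rmorph_prod; congr (_ * _).
    by apply: eq_bigr => i /negbTE ->.
  rewrite mpolyXE_id big_mkcond; apply: eq_bigr => i _.
  by rewrite mnmE; case: (i \in J); rewrite ?expr1 ?expr0.
apply/forallP => x; rewrite rmorph_sum /=.
rewrite (eq_bigr (fun a => (a == x)%:R)) => [|a _].
  case fx: (f x).
    rewrite (bigD1 x) //= eqxx big1 ?addr0 // => a /andP[_ /negbTE -> //].
  rewrite big1 // => a fa; case: eqP => // ax; by rewrite -ax fa in fx.
rewrite /ind rmorph_prod /=.
under eq_bigr do rewrite mevalD mevalXU mevalC.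
case: eqP => [-> | ax].
  by rewrite big1 // => i _; case: (x i); apply/val_inj.
have [i ai] : exists i, a i != x i.
  by apply/existsP; apply: contra_notT ax; rewrite negb_exists =>
    /forallP h; apply/ffunP => i; apply/eqP; have := h i; rewrite negbK.
rewrite (bigD1 i) //=; suff -> : (x i)%:R + (~~ a i)%:R = 0 :> 'F_2 by rewrite mul0r.
by move: ai; case: (a i); case: (x i) => // _; apply/val_inj.
Qed.

Definition anf f : {mpoly 'F_2[n]} := xchoose (anf_exists f).

Lemma anf_multilinear f : multilinear (anf f).
Proof. by case/andP: (xchooseP (anf_exists f)). Qed.

Lemma anf_represents f : represents (anf f) f.
Proof. by case/andP: (xchooseP (anf_exists f)). Qed.

Lemma multilinear_eq0 p :
  multilinear p -> (forall x, p.@[fun i => (x i)%:R] = 0) -> p = 0.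
Proof.
move=> mp p0; apply/eqP; case: (boolP (p == 0)) => // pn0.
have [m0 m0p] : exists m, m \in msupp p.
  by case: (msupp p) (msupp_eq0 p) => [|m s _]; [rewrite eqxx (negbTE pn0) | exists m; rewrite mem_head].
have ex : exists k, has (fun m => mdeg m == k) (msupp p).
  by exists (mdeg m0); apply/hasP; exists m0.
case: (ex_minnP ex) => k /hasP[m mp' /eqP mk] kmin.
have := p0 [ffun i => m i != 0%N]; rewrite mevalE (bigD1_seq m) ?msupp_uniq //=
  [X in _ + X]big1_seq.
  rewrite addr0 big1 ?mulr1 => [|i _]; last first.
    by rewrite ffunE; case: (m i) => [|?] //=; rewrite expr1n.
  by move/eqP; rewrite (negbTE (_ : p@_m != 0)) // -mcoeff_msupp.
move=> m' /andP[m'm m'p].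
case: (boolP [forall i, (m' i <= m i)%N]) => [/forallP le | /forallPn[i]].
  case/eqP: m'm; apply/mnmP.
  have : (mdeg m <= mdeg m')%N by rewrite mk; apply: kmin; apply/hasP; exists m'.
  rewrite !mdegE => lm.
  have [_ e] := leqif_sum (fun i (_ : true) => leqif_eq (le i)).
  have : (\sum_i m' i == \sum_i m i)%N.
    by rewrite eqn_leq lm andbT; apply: leq_sum => i _.
  by rewrite e => /forallP h i; apply/eqP; exact: h.
rewrite -ltnNge => lt.
have mi : m i = 0%N.
  have /allP/(_ _ m'p)/forallP/(_ i) := mp.
  by case: (m i) lt => // j; case: (m' i) => [|[|]].
rewrite (bigD1 i) //= ffunE mi eqxx expr0n.
by rewrite gtn_eqF ?mul0r ?mulr0 // -mi.
Qed.

Lemma anf_unique p f : multilinear p -> represents p f -> p = anf f.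
Proof.
move=> mp /forallP rp; apply/eqP; rewrite -subr_eq0; apply/eqP.
apply: multilinear_eq0 => [|x].
  by apply: multilinearD => //; apply: multilinearN; apply: anf_multilinear.
have /forallP/(_ x)/eqP ra := anf_represents f.
by rewrite mevalB ra (eqP (rp x)) subrr.
Qed.

(* [msize] is one more than the degree, and the zero polynomial gets degree 0. *)
Definition deg2 f : nat := (msize (anf f)).-1.

End GF2Degree.

Section Granularity.

Variables (R : realType) (n : nat).
Implicit Types (f : cube n -> bool) (h : cube n -> R) (S : {set 'I_n}).

Definition indR f : cube n -> R := fun x => (f x)%:R.

Definition pmR f : cube n -> R := fun x => 1 - 2 * indR f x.

Definition fourier h S : R :=
  2 ^- n * \sum_(x : cube n) h x * (-1) ^+ (\sum_(i in S) x i)%N.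

(* Granularity is partial: only dyadic rationals r have one, so it is given by
   its graph.  The exponent is an integer, negative for even integers r. *)
Definition is_gran (r : R) (k : int) : Prop :=
  exists2 m : int, ~~ (2 %| m)%Z & r = m%:~R / 2 ^ k.

Lemma is_gran_inj r k l : is_gran r k -> is_gran r l -> k = l.
Proof.
suff wl (k' l' : int) : is_gran r k' -> is_gran r l' -> l' <= k'.
  by move=> hk hl; apply: le_anti; rewrite (wl _ _ hk hl) (wl _ _ hl hk).
move=> [m om ->] [m' om' e]; rewrite leNgt; apply/negP => lt.
case: (l' - k') (subrK k' l') lt => [[|j]|j] lk;
  [by rewrite -lk add0r ltxx | | by rewrite -lk NegzE ltNge gerDr oppr_le0].
move=> _; have two0 : (2 : R) != 0 by rewrite pnatr_eq0.
have /(congr1 (fun r => r * 2 ^ l')) := e.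
rewrite divfK ?expfz_neq0 // -{1}lk expfzDr //.
rewrite mulrCA divfK ?expfz_neq0 // => mE.
case/negP: om'; apply/dvdzP; exists (m * 2 ^+ j).
apply: (@intr_inj R); rewrite -mE -mulrA -exprSr rmorphM rmorphXn /=.
by rewrite mulrC.
Qed.

(* [k] is the maximum of the granularities of the nonzero Fourier coefficients
   of [h]; in particular all of these have a granularity. *)
Definition is_fourier_gran h (k : int) : Prop :=
  (exists2 S, fourier h S != 0 & is_gran (fourier h S) k) /\
  (forall S, fourier h S != 0 -> exists2 j, is_gran (fourier h S) j & j <= k).

Lemma is_fourier_gran_inj h k l :
  is_fourier_gran h k -> is_fourier_gran h l -> k = l.
Proof.
suff wl (k' l' : int) : is_fourier_gran h k' -> is_fourier_gran h l' -> k' <= l'.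
  by move=> hk hl; apply: le_anti; rewrite (wl _ _ hk hl) (wl _ _ hl hk).
move=> [[S S0 Sk] _] [_ /(_ S S0)[j Sj]].
by rewrite (is_gran_inj Sk Sj).
Qed.

End Granularity.

(* Main.v *)
(* Write [(-1)^(f x)] times a character as a product of factors
   [1 - 2 [A <= x]], one for each monomial [A] of the algebraic normal form of
   [f] and one for each variable of the character.  Every [A] has at most
   [d = deg2 f] elements.  Expanding the product, a choice of [t] factors
   contributes [+-2^t] times the number [2^(n-u)] of points above the union of
   the chosen sets, where [u <= d t]; as [d (t + n - u) >= n], each term is
   divisible by [2^ceil(n/d)].  This is McEliece's divisibility theorem for the
   Fourier sums of [f], which gives the bound on the granularity. *)

Require Import Defs.
From mathcomp Require Import all_boot all_order all_algebra.
From mathcomp Require Import reals.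
From mathcomp Require Import mpoly.
From mathcomp Require Import zify.

Import Order.TTheory GRing.Theory Num.Theory.

Local Open Scope ring_scope.

(** * Powers of 2 dividing sums of signs over the cube *)

Section SignSums.

Variable n : nat.
Implicit Types (x : cube n) (A B S : {set 'I_n}) (L : seq {set 'I_n}).

Definition monom A x : bool := [forall i in A, x i].

Definition sign_prod L x : int := \prod_(A <- L) (1 - 2 * (monom A x)%:R).

Lemma monomU A B x : monom (A :|: B) x = monom A x && monom B x.
Proof.
apply/forall_inP/andP => [h | [/forall_inP hA /forall_inP hB] i].
  by split; apply/forall_inP => i iA; apply: h; rewrite inE iA ?orbT.
by rewrite inE => /orP[/hA|/hB].
Qed.

Lemma monom1 (i : 'I_n) x : monom [set i] x = x i.
Proof.
apply/forall_inP/idP => [-> // | xi j]; first by rewrite inE.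
by rewrite inE => /eqP ->.
Qed.

Lemma prod_nat_bool (I : finType) (P : pred I) (b : I -> bool) :
  (\prod_(i | P i) (b i : nat))%N = [forall (i | P i), b i].
Proof.
case: forall_inP => [h | /forall_inP/forall_inPn[i Pi /negbTE bi]].
  by rewrite big1 // => i /h ->.
by rewrite (bigD1 i) //= bi.
Qed.

Lemma sum_monom A : (\sum_x monom A x)%N = (2 ^ (n - #|A|))%N.
Proof.
transitivity (\prod_(i : 'I_n) \sum_(b : bool) ((i \in A) ==> b))%N.
  rewrite bigA_distr_bigA; apply: eq_bigr => x _.
  by rewrite prod_nat_bool; congr nat_of_bool; apply: eq_forallb.
rewrite (eq_bigr (fun i => if i \in A then 1 else 2)%N) => [|i _]; last first.
  by rewrite big_bool; case: (i \in A).
rewrite (bigID (mem A)) /= big1 => [|i -> //].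
rewrite mul1n (eq_bigr (fun=> 2%N)) => [|i /negbTE -> //].
rewrite prod_nat_const; congr (2 ^ _)%N.
by rewrite -[X in (X - _)%N]card_ord -(cardC A) addKn.
Qed.

(* Expanding one factor [1 - 2 [A <= x]] leaves a sum over the smaller subcube
   [A :|: B <= x]: the codimension grows by at most [d], the bound on the
   degree, and a factor 2 is gained. *)
Lemma dvd_sum_sign_prod d L B c :
  (0 < d)%N -> (forall A, A \in L -> (#|A| <= d)%N) ->
  (d * c < n - #|B| + d)%N ->
  ((2 ^+ c : int) %| \sum_x (monom B x)%:R * sign_prod L x)%Z.
Proof.
move=> d_gt0; elim: L B c => [|A L IH] B c hL hc.
  under eq_bigr do rewrite /sign_prod big_nil mulr1.
  rewrite -natr_sum sum_monom natrX dvdz_exp2l //.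
  have := max_card B; rewrite card_ord; nia.
have hL' A' : A' \in L -> (#|A'| <= d)%N.
  by move=> A'L; rewrite hL ?inE ?A'L ?orbT.
have -> : \sum_x (monom B x)%:R * sign_prod (A :: L) x
  = \sum_x (monom B x)%:R * sign_prod L x
    - 2 * \sum_x (monom (A :|: B) x)%:R * sign_prod L x.
  rewrite mulr_sumr -sumrB; apply: eq_bigr => x _.
  rewrite /sign_prod big_cons monomU mulrBl mul1r mulrBr -mulnb.
  by congr (_ - _); rewrite natrM mulrCA !mulrA.
apply: rpredB; first exact: IH.
(* The bound on [c] says [c <= ceil((n - #|B|) / d)]. Passing to [A :|: B] lowers this ceiling by at
   most 1, which the factor 2 makes up for. *)
case: c hc => [|c] hc; first by rewrite expr0 dvd1z.
rewrite exprS dvdz_mul2l //= IH //.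
have := hL A (mem_head _ _); have := cardsU A B; have := max_card (A :|: B).
rewrite card_ord; nia.
Qed.

Definition msuppset (m : 'X_{1..n}) : {set 'I_n} := [set i | m i != 0%N].

Lemma card_msuppset m : (#|msuppset m| <= mdeg m)%N.
Proof.
rewrite mdegE -sum1_card [leqRHS](bigID (mem (msuppset m))) /=.
by apply/(leq_trans _ (leq_addr _ _))/leq_sum => i; rewrite inE lt0n.
Qed.

Lemma prod_pow_bool (K : comNzRingType) (m : 'X_{1..n}) x :
  \prod_i ((x i)%:R ^+ m i) = (monom (msuppset m) x)%:R :> K.
Proof.
rewrite -prod_nat_bool natr_prod [RHS]big_mkcond; apply: eq_bigr => i _.
rewrite inE; case: (m i) => [|k]; first by rewrite expr0.
by case: (x i); rewrite ?expr1n ?expr0n.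
Qed.

(** The nontrivial additive character of ['F_2]; it turns the sum of monomials in [anf f] into a
    product of signs. *)
Definition F2sign (a : 'F_2) : int := (-1) ^+ (a : nat).

Lemma F2_bool (a : 'F_2) : a = (a != 0)%:R.
Proof. by apply: val_inj; case: a => [[|[|]]]. Qed.

Lemma F2signD : {morph F2sign : a b / a + b >-> a * b}.
Proof. by move=> a b; rewrite (F2_bool a) (F2_bool b); do 2!case: (_ != 0). Qed.

Lemma F2sign_bool (b : bool) : F2sign b%:R = 1 - 2 * b%:R.
Proof. by case: b. Qed.

Lemma sign_anf (f : cube n -> bool) x :
  1 - 2 * (f x)%:R = sign_prod [seq msuppset m | m <- msupp (anf f)] x.
Proof.
have /forallP/(_ x)/eqP := anf_represents f.
rewrite -F2sign_bool => <-.
rewrite mevalE (big_morph F2sign F2signD (erefl : F2sign 0 = 1)).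
rewrite /sign_prod [RHS]big_map.
apply: eq_big_seq => m; rewrite mcoeff_msupp prod_pow_bool -F2sign_bool => m_supp.
by rewrite [(anf f)@_m]F2_bool m_supp mul1r.
Qed.

Lemma sign_parity S x :
  (-1) ^+ (\sum_(i in S) x i)%N = sign_prod [seq [set i] | i <- enum S] x.
Proof.
rewrite /sign_prod big_map big_enum /= -prodrXr; apply: eq_bigr => i _.
by rewrite monom1; case: (x i).
Qed.

Lemma sign_prod_cat L1 L2 x :
  sign_prod (L1 ++ L2) x = sign_prod L1 x * sign_prod L2 x.
Proof. exact: big_cat. Qed.


Lemma dvd_fourier_sum (f : cube n -> bool) S c :
  (0 < deg2 f)%N -> (deg2 f * c < n + deg2 f)%N ->
  ((2 ^+ c : int) %| \sum_x (1 - 2 * (f x)%:R) * (-1) ^+ (\sum_(i in S) x i)%N)%Z.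
Proof.
move=> d_gt0 hc.
pose L := [seq msuppset m | m <- msupp (anf f)] ++ [seq [set i] | i <- enum S].
(* [monom set0] is constantly 1, so the expansion starts from the whole cube. *)
rewrite (eq_bigr (fun x => (monom set0 x)%:R * sign_prod L x)) => [|x _]; last first.
  rewrite sign_prod_cat -sign_anf -sign_parity (_ : monom set0 x) ?mul1r //.
  by apply/forall_inP => i; rewrite inE.
apply: (@dvd_sum_sign_prod (deg2 f)) => // [A|]; last by rewrite cards0 subn0.
(* The singletons coming from the character respect the size bound because [deg2 f] is positive. *)
rewrite mem_cat => /orP[/mapP[m m_supp ->]|/mapP[i _ ->]]; last by rewrite cards1.
apply: leq_trans (card_msuppset m) _.
by have := msize_mdeg_lt m_supp; rewrite /deg2; case: (msize _).
Qed.

(** The case of singletons only, with [d = 1]. It handles the constant term in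
    [2 f = 1 - (1 - 2 f)]. *)
Lemma dvd_character_sum S c : (c <= n)%N ->
  ((2 ^+ c : int) %| \sum_(x : cube n) (-1) ^+ (\sum_(i in S) x i)%N)%Z.
Proof.
move=> c_le.
rewrite (eq_bigr (fun x => (monom set0 x)%:R * sign_prod [seq [set i] | i <- enum S] x))
  => [|x _]; last first.
  rewrite -sign_parity (_ : monom set0 x) ?mul1r //.
  by apply/forall_inP => i; rewrite inE.
apply: (@dvd_sum_sign_prod 1) => // [A /mapP[i _ ->]|]; first by rewrite cards1.
by rewrite cards0; lia.
Qed.

Lemma deg2_gt0 (f : cube n -> bool) :
  ~ (exists b : bool, forall x, f x = b) -> (0 < deg2 f)%N.
Proof.
move=> f_nonconst; rewrite lt0n; apply/eqP => d0; apply: f_nonconst.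
have c_anf : anf f = ((anf f)@_0)%:MP.
  by apply: msize1_polyC; move: d0; rewrite /deg2; case: (msize _) => [|[]].
exists ((anf f)@_0 != 0) => x.
have /forallP/(_ x)/eqP := anf_represents f.
by rewrite {1}c_anf mevalC => ->; case: (f x).
Qed.

End SignSums.

(** * From divisibility to granularity *)

Section FourierGranularity.

Variables (R : realType) (n : nat).
Implicit Types (h : cube n -> R) (S : {set 'I_n}).

Lemma is_gran_dyadic (z : int) (N : nat) : z != 0 ->
  is_gran (z%:~R / 2 ^+ N : R) (N%:Z - (logn 2 `|z|)%:Z).
Proof.
move=> z0; have [m /= om zE] := pfactor_coprime (isT : prime 2) (etrans (absz_gt0 z) z0).
set v := logn 2 _ in zE *; exists ((-1) ^+ (z < 0)%R * m%:Z).
  by rewrite dvdzE abszMsign -prime_coprime.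
have two0 : (2 : R) != 0 by rewrite pnatr_eq0.
apply/eqP; rewrite eqr_div ?expfz_neq0 ?expf_neq0 //; apply/eqP.
rewrite -[X in X%:~R * _](mulz_sign_abs z) zE PoszM mulrA rmorphM /= -mulrA.
congr (_ * _); rewrite -pmulrn natrX -[2 ^+ v]/(2 ^ v%:Z).
by rewrite -expfzDr // addrC subrK.
Qed.

(** Over a common denominator, granularity is [N] minus the 2-adic valuation of the numerator, so
    the maximum sits at a nonzero numerator of least valuation. *)
Lemma is_fourier_gran_dyadic h (z : {set 'I_n} -> int) (N : nat) :
  (forall S, fourier h S = (z S)%:~R / 2 ^+ N) ->
  (exists S, fourier h S != 0) ->
  exists2 k : int, is_fourier_gran h k & k <= N%:Z.
Proof.
have nz S : fourier h S = (z S)%:~R / 2 ^+ N -> (fourier h S != 0) = (z S != 0).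
  by move=> ->; rewrite mulf_eq0 invr_eq0 expf_eq0 pnatr_eq0 andbF orbF intr_eq0.
move=> hz [S0]; rewrite nz // => zS0.
case: (arg_minnP (fun S => logn 2 `|z S|) (P := fun S => z S != 0) zS0) => S zS Smin.
exists (N%:Z - (logn 2 `|z S|)%:Z); last by rewrite gerBl.
split; first by exists S; [rewrite nz | rewrite hz; exact: is_gran_dyadic].
move=> T; rewrite nz // => zT; exists (N%:Z - (logn 2 `|z T|)%:Z).
  by rewrite hz; exact: is_gran_dyadic.
by rewrite lerB // lez_nat Smin.
Qed.

Lemma fourier_inversion h (y : cube n) :
  \sum_S fourier h S * (-1) ^+ (\sum_(i in S) y i)%N = h y.
Proof.
under eq_bigr do rewrite /fourier -mulrA mulr_suml.
rewrite -mulr_sumr exchange_big /=.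
have two0 : (2 : R) ^+ n != 0 by rewrite expf_eq0 pnatr_eq0 andbF.
apply: (mulfI two0); rewrite mulVKf // (bigD1 y) //= [X in _ + X]big1.
  rewrite addr0 (eq_bigr (fun=> h y)) => [|S _]; last first.
    by rewrite -mulrA -expr2 sqrr_sign mulr1.
  have cE : #|{: {set 'I_n}}| = (2 ^ n)%N.
    by rewrite -cardsT -powersetT card_powerset cardsT card_ord.
  by rewrite sumr_const cE -natrX mulr_natl.
move=> x xy; have [i xyi] : exists i, x i != y i.
  apply/existsP; apply: contraNT xy => /existsPn xy.
  by apply/eqP/ffunP => i; apply/eqP/negPn/xy.
under eq_bigr do rewrite -mulrA.
(* Orthogonality: the sum over [S] factors over the coordinates, and the factor at [i], where [x]
   and [y] differ, is 0. *)
rewrite -mulr_sumr (_ : \sum_S _ = \prod_i (((-1) ^+ x i * (-1) ^+ y i) + 1)).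
  rewrite (bigD1 i) //=; move: xyi.
  by case: (x i); case: (y i); rewrite // ?expr0 ?expr1 ?mulr1 ?mul1r addNr mul0r mulr0.
rewrite bigA_distr /=; apply: eq_bigr => S _.
by rewrite -big_mkcond /= big_split /= !prodrXr.
Qed.

Lemma fourier_neq0 h x : h x != 0 -> exists S, fourier h S != 0.
Proof.
move=> hx; apply/existsP; apply: contraNT hx => /existsPn h0.
rewrite -fourier_inversion big1 // => S _.
by have := h0 S; rewrite negbK => /eqP ->; rewrite mul0r.
Qed.

(** The parameter [b] allows for sums known only after doubling: it is 0 for the sign function and 1
    for the indicator. *)
Lemma fourier_dyadic h (g : cube n -> int) S (z : int) b c :
  (forall x, h x = (g x)%:~R) -> (c <= n + b)%N ->
  2 ^+ b * \sum_x g x * (-1) ^+ (\sum_(i in S) x i)%N = z * 2 ^+ c ->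
  fourier h S = z%:~R / 2 ^+ (n + b - c).
Proof.
move=> hg c_le /(congr1 (fun u : int => u%:~R : R)).
rewrite !rmorphM !rmorphXn rmorph_sum /= => sE.
have two0 k : (2 : R) ^+ k != 0 by rewrite expf_eq0 pnatr_eq0 andbF.
rewrite /fourier mulrC; apply/eqP; rewrite eqr_div //; apply/eqP/(mulIf (two0 c)).
rewrite -mulrA -exprD subnK // mulrAC -sE exprD [2 ^+ n * _]mulrC mulrA.
congr (_ * _); rewrite mulrC; congr (_ * _); apply: eq_bigr => x _.
by rewrite hg rmorphM rmorphXn rmorphN1.
Qed.

End FourierGranularity.

(** The last inequality is the division-free form of [c <= ceil(n/d)]; [c <= n] keeps the natural
    subtraction [n - c] from truncating. *)
Lemma ceil_divn (n d : nat) : (0 < d)%N ->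
  exists2 c : nat, Num.ceil (n%:Q / d%:Q) = c%:Z & (c <= n)%N && (d * c < n + d)%N.
Proof.
move=> d_gt0.
have d0 : 0 < d%:Q by rewrite ltr0n.
have : 0 <= Num.ceil (n%:Q / d%:Q).
  by rewrite ceil_ge0 (lt_le_trans (ltrN10 _)) // divr_ge0 ?ler0n.
have := ceilB1_lt (n%:Q / d%:Q).
case: (Num.ceil _) => // c; rewrite ltr_pdivlMr // => lt_c _; exists c => //.
have {}lt_c : (d * c < n + d)%N.
  rewrite -(ltr_nat rat) natrM natrD.
  by move: lt_c; rewrite rmorphB /= mulrBl mul1r ltrBlDr mulrC -!pmulrn.
by rewrite lt_c andbT; nia.
Qed.

Theorem theorem6p3 (R : realType) (n : nat) (f : cube n -> bool)
    (f_nonconst : ~ exists b : bool, forall x : cube n, f x = b) :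
  (1 <= deg2 f)%N /\
  (exists2 k : int, is_fourier_gran (pmR R f) k &
     k <= n%:Z - Num.ceil (n%:Q / (deg2 f)%:Q)) /\
  (exists2 k : int, is_fourier_gran (indR R f) k &
     k <= n%:Z - Num.ceil (n%:Q / (deg2 f)%:Q) + 1).
Proof.
have d_gt0 := deg2_gt0 _ _ f_nonconst; split=> //.
have [c -> /andP[c_le hc]] := ceil_divn n _ d_gt0.
pose chi (S : {set 'I_n}) (x : cube n) : int := (-1) ^+ (\sum_(i in S) x i)%N.
pose s (S : {set 'I_n}) := \sum_x (1 - 2 * (f x)%:R) * chi S x.
have s_dvd S : (2 ^+ c %| s S)%Z by exact: dvd_fourier_sum.
split.
  have [||k ? ?] := @is_fourier_gran_dyadic R n (pmR R f) (fun S => (s S %/ 2 ^+ c)%Z) (n - c).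
  - move=> S; rewrite -[n in RHS]addn0.
    apply: (@fourier_dyadic _ _ _ (fun x => 1 - 2 * (f x)%:R)); rewrite ?addn0 //.
      by move=> x; rewrite /pmR /indR rmorphB rmorphM /= !rmorph_nat.
    by rewrite mul1r divzK.
  (* The sign function has values 1 and -1, so any point serves as witness. *)
  - apply: (@fourier_neq0 _ _ _ [ffun=> false]); rewrite /pmR /indR.
    by rewrite subr_eq0 -natrM (eqr_nat R 1); case: (f _).
  by exists k => //; rewrite subzn.
(* [t S] is twice the character sum of [f]; this doubling costs the extra 1 in the bound. *)
pose t (S : {set 'I_n}) := \sum_x chi S x - s S.
have t_dvd S : (2 ^+ c %| t S)%Z by apply: rpredB => //; exact: dvd_character_sum.
have [||k ? ?] := @is_fourier_gran_dyadic R n (indR R f) (fun S => (t S %/ 2 ^+ c)%Z) (n + 1 - c).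
- move=> S.
  apply: (@fourier_dyadic _ _ _ (fun x => (f x)%:R)); rewrite ?(leq_trans c_le) ?leq_addr //.
    by move=> x; rewrite /indR rmorph_nat.
  rewrite divzK // /t /s -sumrB mulr_sumr; apply: eq_bigr => x _.
  by rewrite -[X in X - _]mul1r -mulrBl opprB addrC subrK mulrA.
- have [x fx] : exists x, f x.
    apply/existsP; apply: contra_notT f_nonconst => /existsPn f0.
    by exists false => x; apply/negbTE/f0.
  by apply: (@fourier_neq0 _ _ _ x); rewrite /indR fx oner_neq0.
by exists k => //; rewrite addrAC -PoszD subzn // (leq_trans c_le) ?leq_addr.
Qed.
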